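(* Let $A,B$ be non-zero integers such that the roots $\alpha,\beta$ of $x^2-Ax-B$ have the property that $\alpha/\beta$ is not a root of unity. Let $u=(u_n)_{n\ge0}$ and $v=(v_n)_{n\ge0}$ be the Lucas sequences of the first and second kind, respectively, corresponding to the pair $(A,B)$. Assume that $A^2+4B>0$. Then $u$ and $v$ admit no three term arithmetic progression, except the cases listed in (i) and (ii), respectively, where triples $(k,l,m)$ of non-negative indices are considered up to exchanging $k$ and $m$. (i) Triples $(k,l,m)$ such that $(u_k,u_l,u_m)$ is a three term arithmetic progression: - $(A,B)=(1,1)$: $(0,1,3)$, $(2,3,4)$, and $(t,t+2,t+3)$ for $t\ge 0$; - $(A,B)=(-1,1)$: $(1,0,2)$, and $(t,t+1,t+3)$ for $t\ge0$; - $(A,B)=(1,2)$: $(1,2t+1,2t+2)$ and $(2,2t+1,2t+2)$ for $t\ge1$; - $(A,B)=(-1,2)$: $(t+2,t,t+1)$ for $t\ge0$; - $(A,B)=(2,B)$ with $B\ge1$: $(0,1,2)$; - $(A,B)=(1,B)$ with $B\ge3$: $(1,3,4)$ and $(2,3,4)$; - $(A,B)=(-1,B)$ with $B\ge3$: $(1,0,2)$. (ii) Triples $(k,l,m)$ such that $(v_k,v_l,v_m)$ is a three term arithmetic progression: - $(A,B)=(1,1)$: $(1,0,2)$, and $(t,t+2,t+3)$ for $t\ge0$; - $(A,B)=(-1,1)$: $(t,t+1,t+3)$ for $t\ge0$; - $(A,B)=(-1,2)$: $(t,t-1,t+1)$ for $t\ge1$; - $(A,B)=(-2,1)$: $(1,0,2)$;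 - $(A,B)=(1,3)$: $(1,4,5)$; - $(A,B)=(-3,-1)$: $(1,0,2)$.
   Context: For non-zero integers $A,B$ such that the ratio $\alpha/\beta$ of the roots of $x^2-Ax-B$ is not a root of unity, the Lucas sequences of the first and second kind corresponding to $(A,B)$ are defined by $u_{n+2}=Au_{n+1}+Bu_n$ and $v_{n+2}=Av_{n+1}+Bv_n$ for $n\ge 0$, with $u_0=0$, $u_1=1$, $v_0=2$, $v_1=A$. ($\gcd(A,B)=1$ is not required.) A three term arithmetic progression $(a,b,c)$ is a triple of pairwise distinct numbers with $a+c=2b$ (either increasing or decreasing).
   Formalization: List (i) is incomplete: for (A,B)=(1,1) the triple (1,4,5) gives 1,3,5, and for (A,B)=(-1,1) the triple (4,1,5) gives -3,1,5; both are progressions not listed. The formal theorem adds exactly these two triples (up to exchanging k and m) to list (i). *)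

(* Defs.v *)
From HB Require Import structures.
From mathcomp Require Import all_boot all_order all_algebra all_field.

Set Implicit Arguments.
Unset Strict Implicit.
Unset Printing Implicit Defensive.

Import Order.TTheory GRing.Theory Num.Theory.
Local Open Scope ring_scope.

Fixpoint lucas_u (A B : int) (n : nat) : int :=
  match n with
  | 0%N => 0
  | n1.+1 =>
    match n1 with
    | 0%N => 1
    | n2.+1 => A * lucas_u A B n1 + B * lucas_u A B n2
    end
  end.

Fixpoint lucas_v (A B : int) (n : nat) : int :=
  match n with
  | 0%N => 2
  | n1.+1 =>
    match n1 with
    | 0%N => A
    | n2.+1 => A * lucas_v A B n1 + B * lucas_v A B n2
    end
  end.

Definition char_poly2 (A B : int) : {poly algC} :=
  'X^2 - A%:~R *: 'X - (B%:~R)%:P.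

Definition is_root_of_unity (z : algC) : Prop :=
  exists2 n : nat, (0 < n)%N & n.-unity_root z.

Definition is_AP3 (a b c : int) : Prop :=
  [/\ a <> b, b <> c, a <> c & a + c = 2 * b].

Definition up_to_swap (P : nat -> nat -> nat -> Prop) (k l m : nat) : Prop :=
  P k l m \/ P m l k.

Definition listed_u (A B : int) (k l m : nat) : Prop :=
  ((A, B) = (1, 1) /\
     [\/ (k, l, m) = (0, 1, 3)%N,
         (k, l, m) = (2, 3, 4)%N
       | exists t : nat, (k, l, m) = (t, t + 2, t + 3)%N])
  \/ ((A, B) = (-1, 1) /\
     ((k, l, m) = (1, 0, 2)%N
      \/ exists t : nat, (k, l, m) = (t, t + 1, t + 3)%N))
  \/ ((A, B) = (1, 2) /\
     exists2 t : nat, (1 <= t)%N &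
       (k, l, m) = (1, 2 * t + 1, 2 * t + 2)%N
       \/ (k, l, m) = (2, 2 * t + 1, 2 * t + 2)%N)
  \/ ((A, B) = (-1, 2) /\
     exists t : nat, (k, l, m) = (t + 2, t, t + 1)%N)
  \/ (A = 2 /\ 1 <= B /\ (k, l, m) = (0, 1, 2)%N)
  \/ (A = 1 /\ 3 <= B /\
     ((k, l, m) = (1, 3, 4)%N \/ (k, l, m) = (2, 3, 4)%N))
  \/ (A = -1 /\ 3 <= B /\ (k, l, m) = (1, 0, 2)%N).

(* Kept apart from [listed_u]: the published list misses these two index
   triples, which are genuine progressions. For (A, B) = (1, 1) the terms of
   index 1, 4, 5 are 1, 3, 5; for (A, B) = (-1, 1) the terms of index 4, 1, 5
   are -3, 1, 5. *)
Definition unlisted_u (A B : int) (k l m : nat) : Prop :=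
  ((A, B) = (1, 1) /\ (k, l, m) = (1, 4, 5)%N)
  \/ ((A, B) = (-1, 1) /\ (k, l, m) = (4, 1, 5)%N).

Definition listed_v (A B : int) (k l m : nat) : Prop :=
  ((A, B) = (1, 1) /\
     ((k, l, m) = (1, 0, 2)%N
      \/ exists t : nat, (k, l, m) = (t, t + 2, t + 3)%N))
  \/ ((A, B) = (-1, 1) /\
     exists t : nat, (k, l, m) = (t, t + 1, t + 3)%N)
  \/ ((A, B) = (-1, 2) /\
     exists2 t : nat, (1 <= t)%N & (k, l, m) = (t, t - 1, t + 1)%N)
  \/ ((A, B) = (-2, 1) /\ (k, l, m) = (1, 0, 2)%N)
  \/ ((A, B) = (1, 3) /\ (k, l, m) = (1, 4, 5)%N)
  \/ ((A, B) = (-3, -1) /\ (k, l, m) = (1, 0, 2)%N).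

(* Main.v *)
Require Import Defs.
From HB Require Import structures.
From mathcomp Require Import all_boot all_order all_algebra all_field.
From mathcomp Require Import zify.

Set Implicit Arguments.
Unset Strict Implicit.
Unset Printing Implicit Defensive.

Import Order.TTheory GRing.Theory Num.Theory.
Local Open Scope ring_scope.

(** Since [u_n(-A, B) = (-1)^(n-1) u_n(A, B)] and [v_n(-A, B) = (-1)^n v_n(A, B)],
    everything is expressed with the sequences of [(|A|, B)], which are positive
    and essentially increasing.  If [B > 0] they satisfy
    [x_(n+1) + x_n <= x_(n+2)]; if [B < 0], positivity of the discriminant forces
    [|A| >= 3], and the terms at least double (up to a unit).  In a progression
    the middle term therefore cannot have the largest index, and the largest
    index [m] must have size at most [2 x_l + x_k].  This leaves
    only the patterns [l = m - 1], [k = m - 1] and [{k, l} = {m - 2, m - 3}]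
    up to ties and small indices; unfolding the recurrence
    in each of them gives the exceptional pairs [(A, B)]. *)

(** * Recurrences and the sign change of the first parameter *)

Lemma lucas_uSS A B n :
  lucas_u A B n.+2 = A * lucas_u A B n.+1 + B * lucas_u A B n.
Proof. by []. Qed.

Lemma lucas_vSS A B n :
  lucas_v A B n.+2 = A * lucas_v A B n.+1 + B * lucas_v A B n.
Proof. by []. Qed.

(** This is the sequence (-1)^n x_n. Writing the sign as a parity test reduces every sign question
    to a case split followed by linear arithmetic. *)
Definition alt (x : nat -> int) (n : nat) : int := if odd n then - x n else x n.

Lemma altS x n : alt x n.+1 = if odd n then x n.+1 else - x n.+1.
Proof. by rewrite /alt /=; case: odd. Qed.

Lemma altSS x n : alt x n.+2 = if odd n then - x n.+2 else x n.+2.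
Proof. by rewrite altS /=; case: odd. Qed.

Lemma lucas_uN A B n : lucas_u (- A) B n = - alt (lucas_u A B) n.
Proof.
rewrite /alt; suff [-> _] : lucas_u (- A) B n = - alt (lucas_u A B) n /\
  lucas_u (- A) B n.+1 = - alt (lucas_u A B) n.+1 by [].
elim: n => [|n [IH1 IH2]] //; split=> //.
rewrite lucas_uSS IH1 IH2 /alt lucas_uSS !oddS; case: (odd n) => /=; lia.
Qed.

Lemma lucas_vN A B n : lucas_v (- A) B n = alt (lucas_v A B) n.
Proof.
suff [-> _] : lucas_v (- A) B n = alt (lucas_v A B) n /\
  lucas_v (- A) B n.+1 = alt (lucas_v A B) n.+1 by [].
elim: n => [|n [IH1 IH2]] //; split=> //.
rewrite lucas_vSS IH1 IH2 /alt lucas_vSS !oddS; case: (odd n) => /=; lia.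
Qed.

Lemma is_AP3_sym a b c : is_AP3 a b c -> is_AP3 c b a.
Proof. by case=> *; split; lia. Qed.

(** * Monotonicity, and growth of the first kind for positive parameters *)

Lemma ler_lincomb (a b x y : int) :
  1 <= a -> 1 <= b -> 0 <= x -> 0 <= y -> x + y <= a * x + b * y.
Proof. nia. Qed.

Lemma homo_from (w : nat -> int) (n0 : nat) :
  (forall n, (n0 <= n)%N -> w n <= w n.+1) ->
  forall i j, (n0 <= i <= j)%N -> w i <= w j.
Proof.
move=> H i j; elim: j => [|j IH] ij; first by have ->: i = 0%N by lia.
have [->//|ne] := eqVneq i j.+1.
have := H j; have := IH; lia.
Qed.

Lemma homo_lt_from (w : nat -> int) (n0 : nat) :
  (forall n, (n0 <= n)%N -> w n < w n.+1) ->
  forall i j, (n0 <= i < j)%N -> w i < w j.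
Proof.
move=> H i j ij; have -> : j = j.-1.+1 by lia.
have Hm : w i <= w j.-1 by apply: (@homo_from _ n0) => [n n0n|]; [have := H n n0n|]; lia.
have := H j.-1; lia.
Qed.

Lemma lucas_u_gt0 (a b : int) (n : nat) : 1 <= a -> 1 <= b -> 0 < lucas_u a b n.+1.
Proof.
move=> a1 b1; suff: 0 < lucas_u a b n.+1 /\ 0 < lucas_u a b n.+2 by case.
elim: n => [|n [IH1 IH2]]; first by split=> //=; lia.
split=> //; rewrite lucas_uSS.
have := ler_lincomb a1 b1 (ltW IH2) (ltW IH1); lia.
Qed.

Lemma lucas_u_ge0 (a b : int) (n : nat) : 1 <= a -> 1 <= b -> 0 <= lucas_u a b n.
Proof. by case: n => // n a1 b1; apply/ltW/lucas_u_gt0. Qed.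

Lemma lucas_u_addle (a b : int) (n : nat) : 1 <= a -> 1 <= b ->
  lucas_u a b n.+1 + lucas_u a b n <= lucas_u a b n.+2.
Proof.
by move=> a1 b1; rewrite lucas_uSS; apply: ler_lincomb => //; apply: lucas_u_ge0.
Qed.

Lemma lucas_u_le (a b : int) (i j : nat) : 1 <= a -> 1 <= b -> (i <= j)%N ->
  lucas_u a b i <= lucas_u a b j.
Proof.
move=> a1 b1 ij; apply: (@homo_from _ 0) => // -[|n] _ //.
have := lucas_u_addle n a1 b1; have := lucas_u_ge0 n a1 b1; lia.
Qed.

(** The condition [2 < j] keeps away from the tie u_1 = u_2, which occurs when a = 1. *)
Lemma lucas_u_lt (a b : int) (i j : nat) : 1 <= a -> 1 <= b -> (i < j)%N -> (2 < j)%N ->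
  lucas_u a b i < lucas_u a b j.
Proof.
move=> a1 b1; case: j => [|[|[|j]]] // ij _.
have := lucas_u_addle j.+1 a1 b1; have := lucas_u_gt0 j a1 b1.
have := @lucas_u_le a b i j.+2 a1 b1; lia.
Qed.

(** The tie u_1 = u_2 for a = 1 is the source of the exceptional triples that differ only by
    exchanging the indices 1 and 2. *)
Lemma lucas_u_inj (a b : int) (i j : nat) : 1 <= a -> 1 <= b -> lucas_u a b i = lucas_u a b j ->
  i = j \/ a = 1 /\ ((i, j) = (1, 2)%N \/ (i, j) = (2, 1)%N).
Proof.
move=> a1 b1; wlog ij : i j / (i < j)%N => [H|] E.
  case: (ltngtP i j) => [ij|ij|->]; [exact: H| |by left].
  case: (H j i ij (esym E)) => [->|[-> [[-> ->]|[-> ->]]]]; [by left|by right; auto|by right; auto].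
have [j2|] := ltnP 2 j; first by have := lucas_u_lt a1 b1 ij j2; lia.
case: j ij E => [|[|[|j]]] //; case: i => [|[|i]] //= _ E _; try lia.
by right; split; [lia|left].
Qed.

(** These are the Jacobsthal numbers (2^n - (-1)^n) / 3. *)
Lemma lucas_u12S n :
  lucas_u 1 2 n.+1 = 2 * lucas_u 1 2 n + (if odd n then -1 else 1).
Proof. by elim: n => // n; rewrite lucas_uSS oddS; case: (odd n) => /=; lia. Qed.

(** * Progressions of the first kind for B > 0 *)

Lemma lucas_u_AP3_pos (a b : int) (k l m : nat) : 1 <= a -> 1 <= b -> (k < m)%N ->
  is_AP3 (lucas_u a b k) (lucas_u a b l) (lucas_u a b m) ->
  listed_u a b k l m \/ unlisted_u a b k l m.
Proof.
move=> a1 b1 km [ukl ulm ukm E].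
have ukm' := lucas_u_le a1 b1 (ltnW km).
have kl : (k < l)%N by rewrite ltnNge; apply/negP => /(lucas_u_le a1 b1); lia.
have lm : (l < m)%N by rewrite ltnNge; apply/negP => /(lucas_u_le a1 b1); lia.
case: m lm km E ulm ukm ukm' => [|[|p]] lm km E ulm ukm ukm'; [lia|lia|].
(* If l <= m - 2, then u_m = 2 u_l - u_k <= 2 u_p, while u_m >= u_(p+1) + u_p >= 2 u_p. Equality
   throughout gives u_k = 0 and the tie u_p = u_(p+1). *)
have [lp|pl] := leqP l p.
  have up := lucas_u_addle p a1 b1.
  have ulp := lucas_u_le a1 b1 lp.
  have upp := lucas_u_le a1 b1 (leqnSn p).
  have uk := lucas_u_ge0 k a1 b1.
  have k0 : k = 0%N by case: (k) uk up E {ukl ukm ukm' kl km} => // q _; have := lucas_u_gt0 q a1 b1; lia.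
  subst k; change (lucas_u a b 0) with (0 : int) in *.
  have upE : lucas_u a b p = lucas_u a b p.+1 by lia.
  have [|[a_1]] := lucas_u_inj a1 b1 upE; first lia.
  case=> [[]|[? ?]]; last lia.
  move=> ?; subst p; have ? : l = 1%N by lia.
  subst l a; move: E => /= E; have ? : b = 1 by lia.
  by subst b; do 2!left; split=> //; constructor 1.
have ? : l = p.+1 by lia.
subst l; rewrite lucas_uSS in E.
have uk := lucas_u_ge0 k a1 b1; have up := lucas_u_ge0 p a1 b1; have up1 := lucas_u_gt0 p a1 b1.
(* With l = m - 1 the relation is u_k + a u_(p+1) + b u_p = 2 u_(p+1), so a <= 2; for a = 2 both u_k
   and u_p vanish. *)
have [a3|a2] := leP 3 a; first nia.
have bup : lucas_u a b p <= b * lucas_u a b p by nia.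
have [a_2|a_1] : a = 2 \/ a = 1 by lia.
  have aE x : a * x = 2 * x by rewrite a_2.
  rewrite aE in E; have uk0 : lucas_u a b k = 0 by lia.
  have up0 : lucas_u a b p = 0 by lia.
  case: (k) uk0 kl => [|q] uk0 kl; last by have := lucas_u_gt0 q a1 b1; lia.
  case: (p) up0 kl => [|q] up0 _; last by have := lucas_u_gt0 q a1 b1; lia.
  by left; do 4!right; left.
have aE x : a * x = x by rewrite a_1 mul1r.
rewrite aE in E; clear bup; case: p pl lm km E ulm ukm ukm' ukl kl up up1 => [|p] pl lm km E ulm ukm ukm' ukl kl up up1.
  by case: (k) kl E => //= _; lia.
rewrite lucas_uSS aE in E.
have up0 := lucas_u_ge0 p a1 b1.
(* For a = 1 one more unfolding of the recurrence leaves a relation governed by the size of b. *)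
have {}E : (b - 1) * lucas_u a b p.+1 + lucas_u a b k = b * lucas_u a b p by nia.
have [b_1|[b_2|b3]] : b = 1 \/ b = 2 \/ 3 <= b by lia.
- have bE x : b * x = x by rewrite b_1 mul1r.
  have {}E : lucas_u a b k = lucas_u a b p by rewrite mulrBl !bE in E; lia.
  have [->|[_ [[-> ->]|[-> ->]]]] := lucas_u_inj a1 b1 E; rewrite a_1 b_1.
  + by left; left; split=> //; constructor 3; exists p; rewrite !addnS addn0.
  + by right; left.
  + by left; left; split=> //; constructor 2.
- have : lucas_u a b p.+1 = 2 * lucas_u a b p + (if odd p then -1 else 1).
    by rewrite a_1 b_2; apply: lucas_u12S.
  have bE x : b * x = 2 * x by rewrite b_2.
  rewrite mulrBl !bE in E; case: ifP => odp Ep; last by lia.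
  have uk1 : lucas_u a b k = lucas_u a b 1 by rewrite /=; lia.
  left; do 2!right; left; split; first by rewrite a_1 b_2.
  (* Here p is odd, l = p + 2 and m = p + 3, so t = (p + 1) / 2. *)
  exists p./2.+1 => //.
  have -> : (2 * p./2.+1 + 1 = p.+2)%N by lia.
  have -> : (2 * p./2.+1 + 2 = p.+3)%N by lia.
  by have [->|[_ []// [->]]] := lucas_u_inj a1 b1 uk1; [left|right].
- case: p E pl lm km ulm ukm ukm' ukl kl up up1 up0 => [|[|p]] E *.
  + by rewrite /= in E; lia.
  + have uk1 : lucas_u a b k = lucas_u a b 1 by rewrite /= in E *; lia.
    left; do 5!right; left; do 2!split=> //.
    by have [->|[_ []// [->]]] := lucas_u_inj a1 b1 uk1; [left|right].
  have up := lucas_u_gt0 p a1 b1.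
  have upp := lucas_u_le a1 b1 (leqnSn p).
  (* The relation becomes (b^2 - b - 1) u_(p+1) + u_k = b u_p, impossible for b >= 3 because u_p <=
     u_(p+1) and u_(p+1) > 0. *)
  rewrite !lucas_uSS !aE in E; nia.
Qed.

Lemma lucas_u_AP3_neg (a b : int) (k l m : nat) : 1 <= a -> 1 <= b -> (k < m)%N ->
  is_AP3 (lucas_u (- a) b k) (lucas_u (- a) b l) (lucas_u (- a) b m) ->
  up_to_swap (listed_u (- a) b) k l m \/ up_to_swap (unlisted_u (- a) b) k l m.
Proof.
rewrite !lucas_uN => a1 b1 km [ukl ulm _ E].
have kl : k <> l by move=> ?; subst.
have lm : l <> m by move=> ?; subst.
have {ukl ulm}E : alt (lucas_u a b) k + alt (lucas_u a b) m = 2 * alt (lucas_u a b) l by lia.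
have uk := lucas_u_ge0 k a1 b1; have ul := lucas_u_ge0 l a1 b1.
have um := lucas_u_ge0 m a1 b1.
have [ml|] := ltnP m l.
  have {}E : 2 * lucas_u a b l <= lucas_u a b k + lucas_u a b m.
    by move: E; rewrite /alt; do 3!case: (odd _); lia.
  case: l ml E kl lm ul => [|[|q]] ml E *; [lia|lia|].
  have := lucas_u_addle q a1 b1; have := lucas_u_gt0 q.+1 a1 b1.
  have := @lucas_u_le a b m q.+1 a1 b1 ml; have := @lucas_u_le a b k q a1 b1; lia.
case: m km E lm um => [|[|p]] km E lm um lem; [lia|lia|].
have up := lucas_u_ge0 p a1 b1; have up1 := lucas_u_gt0 p a1 b1.
have addp := lucas_u_addle p a1 b1.
(* For l = m - 1 the terms of index l and m have opposite signs, so u_m + 2 u_l would equal u_k up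
   to sign, which is too small. *)
have [lp|lp] := eqVneq l p.+1.
  have ukp : lucas_u a b k <= lucas_u a b p by apply: lucas_u_le; lia.
  by move: E; rewrite lp !altSS ?altS /alt; case: (odd p); case: (odd k); lia.
have [kp|kp] := eqVneq k p.+1.
  have [l0|l0] := posnP l.
    have {}E : a * lucas_u a b p.+1 + b * lucas_u a b p = lucas_u a b p.+1.
      move: E; rewrite kp l0 (_ : alt (lucas_u a b) 0 = 0) // !altSS ?altS lucas_uSS; case: (odd p); lia.
    case: p {km um lem up addp lm lp} E up1 kp => [|p] E up1 kp; last first.
      by have := lucas_u_gt0 p a1 b1; nia.
    rewrite /= in E; have a_1 : a = 1 by lia.
    rewrite kp l0 a_1.
    have [b_1|[b_2|b3]] : b = 1 \/ b = 2 \/ 3 <= b by lia.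
    + by left; left; right; left; rewrite b_1; split=> //; left.
    + by left; right; right; right; right; left; rewrite b_2; split=> //; exists 0%N.
    + by left; left; do 6!right.
  have ulgt : 0 < lucas_u a b l by case: (l) l0 => // l' _; apply: lucas_u_gt0.
  (* Since u_m >= u_(m-1) and u_l > 0, the middle term must carry the sign of the term of index
     m. *)
  have olp : odd l = odd p.
    by apply/eqP; move: E; rewrite kp !altSS ?altS /alt; case: (odd p); case: (odd l) => //; lia.
  have {}E : (a - 1) * lucas_u a b p.+1 + b * lucas_u a b p = 2 * lucas_u a b l.
    move: E; rewrite kp !altSS ?altS /alt olp lucas_uSS; case: (odd p); lia.
  have [lpE|lpN] := eqVneq l p.
    subst l; case: p {km um lem lm lp kl ul uk olp} E up up1 kp addp l0 ulgt => // p E up up1 kp addp l0 ulgt.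
    have a_1 : a = 1.
      have := lucas_u_addle p a1 b1; have := lucas_u_ge0 p a1 b1; rewrite !lucas_uSS in E *; nia.
    have b_2 : b = 2 by rewrite a_1 subrr mul0r add0r -a_1 in E; nia.
    left; right; do 3!right; left; rewrite a_1 b_2; split=> //; exists p.+1.
    by rewrite kp !addnS !addn0.
  (* By parity l <= p - 2, so 2 u_l <= 2 u_(q+1) <= u_p with p = q + 3. Equality is needed, which
     forces a = b = 1 and the tie u_1 = u_2, hence the triple (4, 1, 5). *)
  case: p km um lem lm lp kl ul uk olp E up up1 kp addp l0 ulgt lpN => [|[|[|q]]]; try lia.
  move=> km um lem lm lp kl ul uk olp E up up1 kp addp l0 ulgt lpN.
  have addq := lucas_u_addle q.+1 a1 b1.
  have ulq : lucas_u a b l <= lucas_u a b q.+1 by apply: lucas_u_le; lia.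
  have uqq := lucas_u_le a1 b1 (leqnSn q.+1).
  have [a_1|a2] : a = 1 \/ 2 <= a by lia. 2: nia.
  have [b_1|b2] : b = 1 \/ 2 <= b by lia. 2: nia.
  have uqE : lucas_u a b q.+1 = lucas_u a b q.+2 by nia.
  have [|[_ [[q0]|[]]]] := lucas_u_inj a1 b1 uqE; [lia| |lia].
  right; left; right; rewrite a_1 b_1; split=> //; rewrite kp q0.
  by have -> : l = 1%N by lia.
case: p km E lm um lem up up1 addp lp kp => [|q] km E lm um lem up up1 addp lp kp; first by lia.
have addq := lucas_u_addle q a1 b1; have uq := lucas_u_ge0 q a1 b1.
have uqq := lucas_u_le a1 b1 (leqnSn q).
have upgt := lucas_u_gt0 q a1 b1.
have leE : lucas_u a b q.+3 <= 2 * lucas_u a b l + lucas_u a b k.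
  by move: E; rewrite /alt; do 3!case: (odd _); lia.
have mE : lucas_u a b q.+3 = (a * a + b) * lucas_u a b q.+1 + a * b * lucas_u a b q.
  by rewrite !lucas_uSS; nia.
(* As k and l are distinct and at most q + 1, only one of them can be q + 1. Comparison with the
   two-step expansion of u_(q+3) then forces a = b = 1. *)
have leU : 2 * lucas_u a b l + lucas_u a b k <= 2 * lucas_u a b q.+1 + lucas_u a b q.
  have [lq|lq] := eqVneq l q.+1.
    rewrite lq; have : lucas_u a b k <= lucas_u a b q by apply: lucas_u_le; lia.
    lia.
  have : lucas_u a b l <= lucas_u a b q by apply: lucas_u_le; lia.
  have : lucas_u a b k <= lucas_u a b q.+1 by apply: lucas_u_le; lia.
  lia.
have [a_1|a2] : a = 1 \/ 2 <= a by lia.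
  have [b_1|b2] : b = 1 \/ 2 <= b by lia.
    have {}mE : lucas_u a b q.+3 = 2 * lucas_u a b q.+1 + lucas_u a b q.
      by rewrite mE a_1 b_1; lia.
    have [lq|lq] := eqVneq l q.+1.
      have ukq : lucas_u a b k <= lucas_u a b q by apply: lucas_u_le; lia.
      have {}ukq : lucas_u a b k = lucas_u a b q by rewrite lq in leE; lia.
      have [kq|[_ [[k1 q2]|[]]]] := lucas_u_inj a1 b1 ukq; last lia.
        left; left; right; left; rewrite a_1 b_1; split=> //; right; exists q.
        by rewrite lq kq addn1 addn3.
      by move: E; rewrite k1 lq q2 a_1 b_1.
    have ulq : lucas_u a b l <= lucas_u a b q by apply: lucas_u_le; lia.
    have ukq : lucas_u a b k <= lucas_u a b q.+1 by apply: lucas_u_le; lia.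
    have uqE : lucas_u a b q = lucas_u a b q.+1 by lia.
    have [|[_ [[q1]|[]]]] := lucas_u_inj a1 b1 uqE; [lia| |lia].
    (* The tie u_1 = u_2 leaves m = 4 and finitely many k, l, all refuted by computation. *)
    subst q; have l2 : (l < 2)%N by lia.
    have k3 : (k < 3)%N by lia.
    move: E; rewrite a_1 b_1; clear -l2 k3 kl.
    by case: l l2 kl => [|[|l]] // _; case: k k3 => [|[|[|k]]].
  by clear -a_1 b2 leE leU mE upgt uq; nia.
have h1 : 3 <= a * a + b by nia.
have h2 : 1 <= a * b by nia.
by clear -h1 h2 leE leU mE upgt uq; nia.
Qed.

(** * Doubling of the terms for B < 0 *)

(* A ratio c = p / q lying between the two roots of X ^ 2 - a X + b is preserved as
   a lower bound for successive quotients: a - b / r > a - b / c >= c for r > c. *)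
Lemma rec_ratio_lt (a b p q : int) (x : nat -> int) :
  0 < p -> 0 < q -> 0 < b -> p * p + b * (q * q) <= a * (p * q) ->
  (forall n, x n.+2 = a * x n.+1 - b * x n) ->
  0 <= x 0%N -> p * x 0%N < q * x 1%N ->
  forall n, 0 <= x n /\ p * x n < q * x n.+1.
Proof.
move=> p0 q0 b0 pq rec x0 x1; elim=> [//|n [IH0 IH1]].
have xn1 : 0 <= x n.+1 by nia.
split=> //; rewrite rec.
have h1 : b * q * (p * x n) < b * q * (q * x n.+1) by nia.
have h2 : (p * p + b * (q * q)) * x n.+1 <= a * (p * q) * x n.+1 by nia.
suff : p * (p * x n.+1) < p * (q * (a * x n.+1 - b * x n)) by nia.
lia.
Qed.

Lemma rec_double_lt (a b : int) (x : nat -> int) :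
  3 <= a -> 1 <= b -> 4 * b < a * a ->
  (forall n, x n.+2 = a * x n.+1 - b * x n) ->
  0 <= x 0%N -> 2 * x 0%N < x 1%N -> a * x 0%N < 2 * x 1%N ->
  forall n, 0 <= x n /\ 2 * x n < x n.+1.
Proof.
move=> a3 b1 D rec x0 x1 x1' n.
(* The ratio is c = 2 for a = 3, where b <= 2. For a >= 4 it is c = a / 2 >= 2, the midpoint of the
   two roots. *)
have [aE|aN] : a = 3 \/ 4 <= a by lia.
  have b2 : b <= 2 by rewrite aE in D; lia.
  by have := @rec_ratio_lt a b 2 1 x _ _ _ _ rec x0 _ n; rewrite !mul1r aE; apply; lia.
have [] := @rec_ratio_lt a b a 2 x _ _ _ _ rec x0 _ n; try lia.
nia.
Qed.

Lemma lucas_u_double_lt (a b : int) (n : nat) :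
  3 <= a -> 1 <= b -> 4 * b < a * a ->
  0 <= lucas_u a (- b) n /\ 2 * lucas_u a (- b) n < lucas_u a (- b) n.+1.
Proof.
move=> a3 b1 D; apply: (@rec_double_lt a b) => //=; try lia.
Qed.

(** The argument starts at index 1, because v_1 / v_0 is exactly a / 2 and strictness fails at index
    0. The pair a = 3, b = 2 is excluded since 2 v_1 > v_2 there. *)
Lemma lucas_v_double_lt (a b : int) (n : nat) :
  3 <= a -> 1 <= b -> 4 * b < a * a -> b = 1 \/ a <> 3 ->
  2 * lucas_v a (- b) n.+1 < lucas_v a (- b) n.+2.
Proof.
move=> a3 b1 D ab.
have [] := @rec_double_lt a b (fun i => lucas_v a (- b) i.+1) _ _ _ _ _ _ _ n => //=; try lia.
by case: ab => [->|aN]; nia.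
Qed.

(** The roots are 1 and 2, so v_n = 2^n + 1. *)
Lemma lucas_v32S n : lucas_v 3 (- 2) n.+1 = 2 * lucas_v 3 (- 2) n - 1.
Proof. by elim: n => // n; rewrite lucas_vSS; lia. Qed.

(** The unit lost is attained at n = 0 when a = 3, and at every n when moreover b = 2. *)
Lemma lucas_v_double_le (a b : int) (n : nat) :
  3 <= a -> 1 <= b -> 4 * b < a * a ->
  2 * lucas_v a (- b) n - 1 <= lucas_v a (- b) n.+1.
Proof.
move=> a3 b1 D; case: n => [|n]; first by rewrite /=; lia.
have [[aE bE]|ab] : a = 3 /\ b = 2 \/ (b = 1 \/ a <> 3) by nia.
  have : lucas_v a (- b) n.+2 = 2 * lucas_v a (- b) n.+1 - 1.
    by rewrite aE bE; apply: lucas_v32S.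
  lia.
have := lucas_v_double_lt n a3 b1 D ab; lia.
Qed.

Lemma lucas_v_ge2 (a b : int) (n : nat) :
  3 <= a -> 1 <= b -> 4 * b < a * a -> 2 <= lucas_v a (- b) n.
Proof.
move=> a3 b1 D; elim: n => // n; have := lucas_v_double_le n a3 b1 D; lia.
Qed.

Lemma lucas_u_lt_negB (a b : int) (i j : nat) :
  3 <= a -> 1 <= b -> 4 * b < a * a -> (i < j)%N ->
  lucas_u a (- b) i < lucas_u a (- b) j.
Proof.
move=> a3 b1 D ij; apply: (@homo_lt_from _ 0) => // n _.
have [] := lucas_u_double_lt n a3 b1 D; lia.
Qed.

Lemma lucas_v_lt_negB (a b : int) (i j : nat) :
  3 <= a -> 1 <= b -> 4 * b < a * a -> (i < j)%N ->
  lucas_v a (- b) i < lucas_v a (- b) j.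
Proof.
move=> a3 b1 D ij; apply: (@homo_lt_from _ 0) => // n _.
have := lucas_v_double_le n a3 b1 D; have := lucas_v_ge2 n a3 b1 D; lia.
Qed.

(** * Progressions for B < 0 *)

Lemma lucas_u_AP3_pos_negB (a b : int) (k l m : nat) :
  3 <= a -> 1 <= b -> 4 * b < a * a -> (k < m)%N ->
  ~ is_AP3 (lucas_u a (- b) k) (lucas_u a (- b) l) (lucas_u a (- b) m).
Proof.
move=> a3 b1 D km [_ ulm _ E].
have ukm := lucas_u_lt_negB a3 b1 D km.
have lm : (l < m)%N.
  by case: (ltngtP l m) => // [/(lucas_u_lt_negB a3 b1 D)|lm]; [lia|subst].
case: m lm km E ulm ukm => // m lm _ E _ _.
have [uk _] := lucas_u_double_lt k a3 b1 D.
have [_ um] := lucas_u_double_lt m a3 b1 D.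
have [lm'|] := ltnP l m; first by have := lucas_u_lt_negB a3 b1 D lm'; lia.
move=> ml; have lmE : l = m by lia.
subst; lia.
Qed.

(** The unit lost in doubling is compensated by v_k >= 2: 2 v_l <= 2 v_(m-1) <= v_m + 1 < v_m +
    v_k. *)
Lemma lucas_v_AP3_pos_negB (a b : int) (k l m : nat) :
  3 <= a -> 1 <= b -> 4 * b < a * a -> (k < m)%N ->
  ~ is_AP3 (lucas_v a (- b) k) (lucas_v a (- b) l) (lucas_v a (- b) m).
Proof.
move=> a3 b1 D km [_ ulm _ E].
have ukm := lucas_v_lt_negB a3 b1 D km.
have lm : (l < m)%N.
  by case: (ltngtP l m) => // [/(lucas_v_lt_negB a3 b1 D)|lm]; [lia|subst].
case: m lm km E ulm ukm => // m lm _ E _ _.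
have uk := lucas_v_ge2 k a3 b1 D.
have um := lucas_v_double_le m a3 b1 D.
have [lm'|] := ltnP l m; first by have := lucas_v_lt_negB a3 b1 D lm'; lia.
move=> ml; have lmE : l = m by lia.
subst; lia.
Qed.

Lemma lucas_u_AP3_neg_negB (a b : int) (k l m : nat) :
  3 <= a -> 1 <= b -> 4 * b < a * a -> (k < m)%N ->
  ~ is_AP3 (lucas_u (- a) (- b) k) (lucas_u (- a) (- b) l) (lucas_u (- a) (- b) m).
Proof.
rewrite !lucas_uN => a3 b1 D km [ukl ulm _ E].
have kl : k <> l by move=> ?; subst.
have lm : l <> m by move=> ?; subst.
have {ukl ulm}E : alt (lucas_u a (- b)) k + alt (lucas_u a (- b)) m = 2 * alt (lucas_u a (- b)) l by lia.
have [uk _] := lucas_u_double_lt k a3 b1 D; have [ul _] := lucas_u_double_lt l a3 b1 D.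
have [um _] := lucas_u_double_lt m a3 b1 D.
have km' := lucas_u_lt_negB a3 b1 D km.
have [/(lucas_u_lt_negB a3 b1 D) ml|] := ltnP m l.
  by move: E; rewrite /alt; do 3!case: (odd _); lia.
case: m km km' E lm um => [|[|p]] km km' E lm um lem; [lia|lia|].
have [up dp] := lucas_u_double_lt p a3 b1 D.
have [_ dp1] := lucas_u_double_lt p.+1 a3 b1 D.
have lt_le i j : (i <= j)%N -> lucas_u a (- b) i <= lucas_u a (- b) j.
  by rewrite leq_eqVlt => /orP[/eqP->//|/(lucas_u_lt_negB a3 b1 D)/ltW].
have [lp|lp] := eqVneq l p.+1.
  have ukp : lucas_u a (- b) k <= lucas_u a (- b) p by apply: lt_le; lia.
  by move: E; rewrite lp !altSS ?altS /alt; case: (odd p); case: (odd k); lia.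
have ulp : lucas_u a (- b) l <= lucas_u a (- b) p by apply: lt_le; lia.
have leE : lucas_u a (- b) p.+2 <= 2 * lucas_u a (- b) l + lucas_u a (- b) k.
  by move: E; rewrite /alt; do 3!case: (odd _); lia.
have [kp|kp] := eqVneq k p.+1; first by subst; lia.
have ukp : lucas_u a (- b) k <= lucas_u a (- b) p by apply: lt_le; lia.
lia.
Qed.

Lemma lucas_v_AP3_neg_negB (a b : int) (k l m : nat) :
  3 <= a -> 1 <= b -> 4 * b < a * a -> (k < m)%N ->
  is_AP3 (lucas_v (- a) (- b) k) (lucas_v (- a) (- b) l) (lucas_v (- a) (- b) m) ->
  listed_v (- a) (- b) k l m.
Proof.
rewrite !lucas_vN => a3 b1 D km [vkl vlm _ E].
have kl : k <> l by move=> ?; subst.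
have lm : l <> m by move=> ?; subst.
have vk := lucas_v_ge2 k a3 b1 D; have vl := lucas_v_ge2 l a3 b1 D.
have vm := lucas_v_ge2 m a3 b1 D.
have km' := lucas_v_lt_negB a3 b1 D km.
have [/(lucas_v_lt_negB a3 b1 D) ml|] := ltnP m l.
  by move: E; rewrite /alt; do 3!case: (odd _); lia.
case: m km km' E lm vm {vkl vlm} => [|[|p]] km km' E lm vm lem; [lia|lia|].
have vp := lucas_v_ge2 p a3 b1 D; have dp := lucas_v_double_le p a3 b1 D.
have dp1 := lucas_v_double_le p.+1 a3 b1 D.
have lt_le i j : (i <= j)%N -> lucas_v a (- b) i <= lucas_v a (- b) j.
  by rewrite leq_eqVlt => /orP[/eqP->//|/(lucas_v_lt_negB a3 b1 D)/ltW].
have [lp|lp] := eqVneq l p.+1.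
  have vkp : lucas_v a (- b) k <= lucas_v a (- b) p by apply: lt_le; lia.
  by move: E; rewrite lp !altSS ?altS /alt; case: (odd p); case: (odd k); lia.
have vlp : lucas_v a (- b) l <= lucas_v a (- b) p by apply: lt_le; lia.
have leE : lucas_v a (- b) p.+2 <= 2 * lucas_v a (- b) l + lucas_v a (- b) k.
  by move: E; rewrite /alt; do 3!case: (odd _); lia.
(* When k and l are both at most p, their distinctness puts one of them at most p - 1, and this
   sharper bound absorbs the lost units. *)
have [kp|kp] := eqVneq k p.+1; last first.
  case: p E km lm lem km' vm vp dp dp1 lp kp vlp leE => [|q] *; first lia.
  have dq := lucas_v_double_le q a3 b1 D.
  have vq := lucas_v_ge2 q a3 b1 D.
  have [lq|lq] := eqVneq l q.+1.
    have vkq : lucas_v a (- b) k <= lucas_v a (- b) q by apply: lt_le; lia.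
    lia.
  have vlq : lucas_v a (- b) l <= lucas_v a (- b) q by apply: lt_le; lia.
  have vkq : lucas_v a (- b) k <= lucas_v a (- b) q.+1 by apply: lt_le; lia.
  lia.
have olp : odd l = odd p.
  by apply/eqP; move: E; rewrite kp !altSS ?altS /alt; case: (odd p); case: (odd l) => //; lia.
have {}E : lucas_v a (- b) p.+2 - lucas_v a (- b) p.+1 = 2 * lucas_v a (- b) l.
  by move: E; rewrite kp !altSS ?altS /alt olp; case: (odd p); lia.
have [[aE bE]|ab] : a = 3 /\ b = 2 \/ (b = 1 \/ a <> 3) by nia.
  have dbl n : lucas_v a (- b) n.+1 = 2 * lucas_v a (- b) n - 1.
    by rewrite aE bE; apply: lucas_v32S.
  (* With v_n = 2^n + 1 the relation reads 2^(p+1) = 2^(l+1) + 2, whose only solution p = 1, l = 0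
     violates the parity condition. *)
  have [lpE|lpN] := eqVneq l p; first by subst l; have := dbl p; have := dbl p.+1; lia.
  case: p kl km km' E lm vm lem vp dp dp1 lp vlp leE kp olp lpN => [|[|q]] *; [lia|lia|].
  have := dbl q; have := dbl q.+1; have := dbl q.+2; have := dbl q.+3.
  have : lucas_v a (- b) l <= lucas_v a (- b) q by apply: lt_le; lia.
  have := lucas_v_ge2 q a3 b1 D; lia.
have ddp := lucas_v_double_lt p a3 b1 D ab.
case: p kl km km' E lm vm lem vp dp dp1 lp vlp leE kp olp ddp => [|p] kl km km' E lm vm lem vp dp dp1 lp vlp leE kp *; last first.
  have := lucas_v_double_lt p a3 b1 D ab; lia.
have l0 : l = 0%N by lia.
move: E; rewrite l0 /= => E.
(* Here 2 b = a^2 - a - 4, and 4 b < a^2 gives (a - 4)(a + 2) < 0. *)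
have a_3 : a = 3 by nia.
have b_1 : b = 1 by rewrite a_3 in E; lia.
by do 5!right; rewrite a_3 b_1 kp.
Qed.

(** * Growth of the second kind for B > 0 *)

Lemma lucas_v_gt0 (a b : int) (n : nat) : 1 <= a -> 1 <= b -> 0 < lucas_v a b n.
Proof.
move=> a1 b1; suff: 0 < lucas_v a b n /\ 0 < lucas_v a b n.+1 by case.
elim: n => [|n [IH1 IH2]]; first by split=> //=; lia.
split=> //; rewrite lucas_vSS.
have := ler_lincomb a1 b1 (ltW IH2) (ltW IH1); lia.
Qed.

Lemma lucas_v_addle (a b : int) (n : nat) : 1 <= a -> 1 <= b ->
  lucas_v a b n.+1 + lucas_v a b n <= lucas_v a b n.+2.
Proof.
by move=> a1 b1; rewrite lucas_vSS; apply: ler_lincomb => //; apply/ltW/lucas_v_gt0.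
Qed.

(** Only v_0 = 2 and v_1 = a can be out of order. The sequence increases from index 1 on, and v_0 is
    compared through v_2 = a^2 + 2 b > 2. *)
Lemma lucas_v_lt (a b : int) (i j : nat) : 1 <= a -> 1 <= b ->
  (i < j)%N -> (1 < j)%N -> lucas_v a b i < lucas_v a b j.
Proof.
move=> a1 b1 ij j1.
have mono i' j' : (1 <= i' < j')%N -> lucas_v a b i' < lucas_v a b j'.
  apply: homo_lt_from => -[|n] // _.
  have := lucas_v_addle n a1 b1; have := lucas_v_gt0 n a1 b1; lia.
case: i ij => [|i] ij; last by apply: mono; lia.
have v2 : lucas_v a b 0 < lucas_v a b 2 by rewrite /=; nia.
by have [->//|j2] := eqVneq j 2; apply: lt_trans v2 (mono _ _ _); lia.
Qed.

Lemma lucas_v_le (a b : int) (i j : nat) : 1 <= a -> 1 <= b ->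
  (i <= j)%N -> (i + j != 1)%N -> lucas_v a b i <= lucas_v a b j.
Proof.
move=> a1 b1; rewrite leq_eqVlt => /orP[/eqP->//|ij] ij1.
by apply/ltW/lucas_v_lt => //; lia.
Qed.

(** Here v_n = 2^n + (-1)^n. *)
Lemma lucas_v12S n :
  lucas_v 1 2 n.+1 = 2 * lucas_v 1 2 n + (if odd n then 3 else - 3).
Proof. by elim: n => // n; rewrite lucas_vSS oddS; case: (odd n) => /=; lia. Qed.

(** * Progressions of the second kind for B > 0 *)

Lemma lucas_v_AP3_pos (a b : int) (k l m : nat) : 1 <= a -> 1 <= b -> (k < m)%N ->
  is_AP3 (lucas_v a b k) (lucas_v a b l) (lucas_v a b m) -> listed_v a b k l m.
Proof.
move=> a1 b1 km [vkl vlm vkm E].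
have vk := lucas_v_gt0 k a1 b1.
case: m km vlm vkm E => [|[|p]] km vlm vkm E; first by [].
  have k0 : k = 0%N by lia.
  have l2 : (1 < l)%N by case: (l) vkl vlm => [|[|]] //; rewrite k0.
  have := lucas_v_lt a1 b1 l2 l2; have : lucas_v a b k < lucas_v a b l by apply: lucas_v_lt; lia.
  lia.
have vkp2 : lucas_v a b k < lucas_v a b p.+2 by apply: lucas_v_lt.
have lp2 : (l < p.+2)%N.
  by rewrite ltnNge; apply/negP => ml; have : lucas_v a b p.+2 <= lucas_v a b l by [apply: lucas_v_le; lia]; lia.
have [l0|l0] := posnP l.
  have k1 : k = 1%N.
    case: (k) vkl vkp2 E => [|[|k']] //; first by rewrite l0.
    have := @lucas_v_lt a b 0 k'.+2 a1 b1; rewrite l0; lia.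
  rewrite k1 l0 [lucas_v a b 0]/= [lucas_v a b 1]/= in E vkl.
  case: p {km vlm vkm lp2 vkp2} E => [|p] E.
    rewrite /= in E; have [a_1 b_1] : a = 1 /\ b = 1 by nia.
    by left; rewrite a_1 b_1; split=> //; left; rewrite k1 l0.
  have := @lucas_v_lt a b 2 p.+3 a1 b1; rewrite [lucas_v a b 2]/=; nia.
have [lp|pl] := leqP l p.
  have addp := lucas_v_addle p a1 b1.
  have vlp : lucas_v a b l <= lucas_v a b p by apply: lucas_v_le; lia.
  have : lucas_v a b p < lucas_v a b p.+1 by apply: lucas_v_lt; lia.
  lia.
have lE : l = p.+1 by lia.
subst l; rewrite lucas_vSS in E.
have vp := lucas_v_gt0 p a1 b1; have vp1 := lucas_v_gt0 p.+1 a1 b1.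
have [a_1|a2] : a = 1 \/ 2 <= a by lia. 2: nia.
have aE x : a * x = x by rewrite a_1 mul1r.
rewrite aE in E.
case: p E vp vp1 km vlm vkm vkp2 vkl {lp2 l0 pl} => [|q] E vp vp1 km vlm vkm vkp2 vkl.
  rewrite /= in E; lia.
have vq := lucas_v_gt0 q a1 b1.
rewrite [lucas_v a b q.+2]lucas_vSS aE in E.
have {}E : (b - 1) * lucas_v a b q.+1 + lucas_v a b k = b * lucas_v a b q by lia.
have k2 : (k <> q.+2) by move=> ?; subst.
have [b_1|[b_2|b3]] : b = 1 \/ b = 2 \/ 3 <= b by lia.
- have bE x : b * x = x by rewrite b_1 mul1r.
  rewrite mulrBl !bE in E.
  suff -> : k = q.
    left; rewrite a_1 b_1; split=> //; right; exists q; by rewrite addn2 addn3.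
  case: (ltngtP k q) => // [kq|qk].
    have [q1|q2] := leqP q 1; last by have := lucas_v_lt a1 b1 kq q2; lia.
    have [? ?] : k = 0%N /\ q = 1%N by lia.
    by subst; rewrite /= in E; lia.
  have [k1|k3] := leqP k 1; last by have := lucas_v_lt a1 b1 qk k3; lia.
  have [? ?] : k = 1%N /\ q = 0%N by lia.
  by subst; rewrite /= in E; lia.
- have bE x : b * x = 2 * x by rewrite b_2.
  have : lucas_v a b q.+1 = 2 * lucas_v a b q + (if odd q then 3 else - 3).
    by rewrite a_1 b_2; apply: lucas_v12S.
  rewrite mulrBl !bE in E; case: ifP => _ Eq; first by lia.
  (* The value 3 is not taken: the sequence begins 2, 1, 5 and increases afterwards. *)
  have vk3 : lucas_v a b k = 3 by lia.
  have v2 : lucas_v a b 2 = 5 by rewrite /=; nia.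
  case: (k) vk3 => [|[|[|k']]]; rewrite ?v2 //.
    by rewrite /= a_1.
  have := @lucas_v_lt a b 2 k'.+3 a1 b1; lia.
- case: q E vp vp1 vq km vlm vkm vkp2 vkl k2 => [|[|r]] E vp vp1 vq km vlm vkm vkp2 vkl k2.
  + case: (k) km k2 E => [|[|[|]]] //= *; nia.
  + rewrite /= in E; nia.
  have vr := lucas_v_gt0 r a1 b1.
  have {}E : b * b * lucas_v a b r.+1 + lucas_v a b k = (b + 1) * lucas_v a b r.+1 + b * lucas_v a b r.
    by rewrite !lucas_vSS !aE in E *; nia.
  case: r {vp vp1 vkl vlm vkm vkp2} E km k2 vr vq => [|r] E km k2 vr vq.
    have v1 : lucas_v a b 1 = 1 by rewrite /= a_1.
    rewrite v1 [lucas_v a b 0]/= in E.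
    (* The relation is b^2 + v_k = 3 b + 1, so b = 3 and v_k = 1: the triple (1, 4, 5). *)
    have [b_3|b4] : b = 3 \/ 4 <= b by lia. 2: nia.
    have vk1 : lucas_v a b k = 1 by have bb : b * b = 9 by [rewrite b_3]; lia.
    have k1 : k = 1%N.
      case: (k) vk1 => [|[|k']] // vk1.
      have := @lucas_v_lt a b 0 k'.+2 a1 b1; rewrite [lucas_v a b 0]/=; lia.
    by do 4!right; left; rewrite a_1 b_3 k1.
  have vlt := @lucas_v_lt a b r.+1 r.+2 a1 b1 (ltnSn _) isT.
  have vr2 := lucas_v_gt0 r.+2 a1 b1.
  have h0 : 3 * b <= b * b by nia.
  have h1 : 3 * (b * lucas_v a b r.+2) <= b * b * lucas_v a b r.+2 by clear -h0 vr2; nia.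
  have h2 : b * lucas_v a b r.+1 <= b * lucas_v a b r.+2 by clear -vlt vr2 b3; nia.
  have h3 : 3 * lucas_v a b r.+2 <= b * lucas_v a b r.+2 by clear -vlt vr2 b3; nia.
  lia.
Qed.

Lemma lucas_v_AP3_neg (a b : int) (k l m : nat) : 1 <= a -> 1 <= b -> (k < m)%N ->
  is_AP3 (lucas_v (- a) b k) (lucas_v (- a) b l) (lucas_v (- a) b m) ->
  listed_v (- a) b k l m.
Proof.
rewrite !lucas_vN => a1 b1 km [vkl vlm _ E].
have kl : k <> l by move=> ?; subst.
have lm : l <> m by move=> ?; subst.
have vk := lucas_v_gt0 k a1 b1; have vl := lucas_v_gt0 l a1 b1.
have vm := lucas_v_gt0 m a1 b1.
have [ml|] := ltnP m l.
  have {}E : 2 * lucas_v a b l <= lucas_v a b k + lucas_v a b m.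
    by move: E; rewrite /alt; do 3!case: (odd _); lia.
  have : lucas_v a b m < lucas_v a b l by apply: lucas_v_lt; lia.
  have : lucas_v a b k < lucas_v a b l by apply: lucas_v_lt; lia.
  lia.
case: m km E lm vm {vkl vlm} => [|[|p]] km E lm vm lem; [lia|lia|].
have vkm : lucas_v a b k < lucas_v a b p.+2 by apply: lucas_v_lt; lia.
have vp := lucas_v_gt0 p a1 b1; have vp1 := lucas_v_gt0 p.+1 a1 b1.
have addp := lucas_v_addle p a1 b1.
have [lp|lp] := eqVneq l p.+1.
  by move: E; rewrite lp !altSS ?altS /alt; case: (odd p); case: (odd k); lia.
have [kp|kp] := eqVneq k p.+1.
  have olp : odd l = odd p.
    by apply/eqP; move: E; rewrite kp !altSS ?altS /alt; case: (odd p); case: (odd l) => //; lia.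
  have {}E : (a - 1) * lucas_v a b p.+1 + b * lucas_v a b p = 2 * lucas_v a b l.
    by move: E; rewrite kp !altSS ?altS /alt olp lucas_vSS; case: (odd p); lia.
  have [lpE|lpN] := eqVneq l p.
    rewrite kp lpE; rewrite lpE in E.
    have [a_1|a2] : a = 1 \/ 2 <= a by lia.
      have aE x : (a - 1) * x = 0 by rewrite a_1 subrr mul0r.
      have b_2 : b = 2 by rewrite aE in E; nia.
      by do 2!right; left; rewrite a_1 b_2; split=> //; exists p.+1; rewrite // subn1 addn1.
    case: p {km lm vm lem vkm kp lp kl lpE olp} E vp vp1 addp => [|p] E vp vp1 addp.
      rewrite /= in E; have a_2 : a = 2 by nia.
      have b_1 : b = 1 by rewrite a_2 in E; lia.
      by do 3!right; left; rewrite a_2 b_1.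
    have := @lucas_v_lt a b p.+1 p.+2 a1 b1 (ltnSn _) isT; nia.
  case: p km E lm vm lem vkm vp vp1 addp lp kp olp lpN => [|[|q]] km E lm vm lem vkm vp vp1 addp lp kp olp lpN; [lia|lia|].
  have ol : odd l = odd q by rewrite olp /= negbK.
  have addq := lucas_v_addle q a1 b1.
  case: q km E lm vm lem vkm vp vp1 addp lp kp olp lpN ol addq => [|q] km E lm vm lem vkm vp vp1 addp lp kp olp lpN ol addq.
    have l0 : l = 0%N by case: l lem lm lp lpN ol {kl vl olp E} => [|[|[|[|[|l]]]]].
    rewrite l0 /= in E; nia.
  have : lucas_v a b l <= lucas_v a b q.+1 by apply: lucas_v_le; lia.
  have : lucas_v a b q.+1 < lucas_v a b q.+2 by apply: lucas_v_lt; lia.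
  nia.
case: p km E lm vm lem vkm vp vp1 addp lp kp => [|[|[|q]]] km E lm vm lem vkm vp vp1 addp lp kp.
- lia.
- have [[k0 l1]|[k1 l0]] : (k = 0 /\ l = 1 \/ k = 1 /\ l = 0)%N by lia.
    rewrite k0 l1 /alt /= in E; have [a_1 b_1] : a = 1 /\ b = 1.
      clear -E a1 b1; have [a_1|a2] : a = 1 \/ 2 <= a by lia.
        by rewrite a_1 in E; lia.
      have h : 4 <= a * a by nia.
      have : 4 * a <= a * (a * a) by nia.
      nia.
    by right; left; rewrite a_1 b_1 k0 l1; split=> //; exists 0%N.
  rewrite k1 l0 /alt /= in E; nia.
(* The index m = 4 is treated apart because v_0 and v_1 may be out of order. Unless a = b = 1, the
   estimate 2 v_2 + v_1 < v_4 rules out all k, l <= 2. *)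
- have v4 : lucas_v a b 4 = a * a * (a * a) + 4 * (a * a * b) + 2 * (b * b).
    by rewrite /=; lia.
  have v2 : lucas_v a b 2 = a * a + 2 * b by rewrite /=; lia.
  have h1 : 1 <= a * a by nia.
  have h2 : a <= a * a by nia.
  have h3 : b <= b * b by nia.
  have h4 : b <= a * a * b by nia.
  have h5 : a * a <= a * a * (a * a) by nia.
  have k3 : (k < 3)%N by lia.
  have l3 : (l < 3)%N by lia.
  have v1 : lucas_v a b 1 = a by [].
  have v0 : lucas_v a b 0 = 2 by [].
  move: E kl; rewrite /alt v4; clear -k3 l3 a1 b1 v4 v2 v1 v0 h1 h2 h3 h4 h5.
  have [[a_1 b_1]|ab] : a = 1 /\ b = 1 \/ 2 <= a * b by nia.
    move: k3 l3; rewrite a_1 b_1.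
    case: k => [|[|[|k]]] // _; case: l => [|[|[|l]]] // _ _ _.
    by right; left; split=> //; exists 1%N.
  have h6 : 2 * (a * a) + a < a * a * (a * a) + 4 * (a * a * b) + 2 * (b * b) - 4 * b.
    have [a_1|a2] : a = 1 \/ 2 <= a by lia.
      by clear -a_1 ab b1; rewrite a_1 in ab *; nia.
    have s4 : 4 <= a * a by nia.
    have h7 : 4 * (a * a) <= a * a * (a * a) by nia.
    lia.
  case: k k3 => [|[|[|k]]] // _; case: l l3 => [|[|[|l]]] // _;
    rewrite ?v2 ?v1 ?v0 /=; lia.
have leE : lucas_v a b q.+4.+1 <= 2 * lucas_v a b l + lucas_v a b k.
  by move: E; rewrite /alt; do 3!case: (odd _); lia.
have vq := lucas_v_gt0 q.+2 a1 b1.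
have vqq : lucas_v a b q.+2 < lucas_v a b q.+3 by apply: lucas_v_lt; lia.
have mE : lucas_v a b q.+4.+1 = (a * a + b) * lucas_v a b q.+3 + a * b * lucas_v a b q.+2.
  by rewrite !lucas_vSS; lia.
have leV : 2 * lucas_v a b l + lucas_v a b k <= 2 * lucas_v a b q.+3 + lucas_v a b q.+2
    /\ (l <> q.+3 -> 2 * lucas_v a b l + lucas_v a b k < 2 * lucas_v a b q.+3 + lucas_v a b q.+2).
  have [lq|lq] := eqVneq l q.+3.
    have : lucas_v a b k <= lucas_v a b q.+2 by apply: lucas_v_le; lia.
    by rewrite lq; split; lia.
  have : lucas_v a b l <= lucas_v a b q.+2 by apply: lucas_v_le; lia.
  have : lucas_v a b k <= lucas_v a b q.+3 by apply: lucas_v_le; lia.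
  by split; lia.
(* If a^2 + b >= 3, the expansion of v_m exceeds 2 v_l + v_k; for a = b = 1 equality must hold,
   fixing l and k. *)
have [[a_1 b_1]|ab] : a = 1 /\ b = 1 \/ 3 <= a * a + b by nia.
  have {}mE : lucas_v a b q.+4.+1 = 2 * lucas_v a b q.+3 + lucas_v a b q.+2.
    by rewrite mE a_1 b_1; lia.
  have lE : l = q.+3 by case: leV => _; lia.
  have kE : k = q.+2.
    have [kq|kq|//] := ltngtP k q.+2; last lia.
    have := @lucas_v_lt a b k q.+2 a1 b1 kq isT; rewrite lE in leE; lia.
  right; left; rewrite a_1 b_1; split=> //; exists q.+2.
  by rewrite lE kE addn1 addn3.
have h2 : 1 <= a * b by nia.
by case: leV => leV _; clear -ab h2 leE leV mE vq vqq; nia.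
Qed.

(** * Converse: the exceptional triples are progressions *)

(** Both gaps equal b - a, so one inequality gives all three. *)
Lemma is_AP3P (a b c : int) : a + c = 2 * b -> a <> b -> is_AP3 a b c.
Proof. by move=> E ab; split; lia. Qed.

Lemma AP3_rec11 (x : nat -> int) t : (forall n, x n.+2 = x n.+1 + x n) ->
  0 < x t.+1 -> is_AP3 (x t) (x (t + 2)%N) (x (t + 3)%N).
Proof. by rewrite addn2 addn3 => rec xt; apply: is_AP3P; rewrite !rec; lia. Qed.

Lemma AP3_recN11 (x : nat -> int) t : (forall n, x n.+2 = - x n.+1 + x n) ->
  x t <> x t.+1 -> is_AP3 (x t) (x (t + 1)%N) (x (t + 3)%N).
Proof. by rewrite addn1 addn3 => rec xt; apply: is_AP3P; rewrite ?rec; lia. Qed.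

Lemma AP3_recN12 (x : nat -> int) t : (forall n, x n.+2 = - x n.+1 + 2 * x n) ->
  x t <> x t.+1 -> is_AP3 (x (t + 2)%N) (x t) (x (t + 1)%N).
Proof.
by rewrite addn1 addn2 => rec xt; apply: is_AP3_sym; apply: is_AP3P; rewrite ?rec; lia.
Qed.

(** Nonzero consecutive terms have opposite signs, and only u_0 vanishes. *)
Lemma lucas_u_neg_neqS (a b : int) (n : nat) : 1 <= a -> 1 <= b ->
  lucas_u (- a) b n <> lucas_u (- a) b n.+1.
Proof.
move=> a1 b1; rewrite !lucas_uN altS /alt.
have := lucas_u_ge0 n a1 b1; have := lucas_u_gt0 n a1 b1; case: (odd n); lia.
Qed.

Lemma lucas_v_neg_neqS (a b : int) (n : nat) : 1 <= a -> 1 <= b ->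
  lucas_v (- a) b n <> lucas_v (- a) b n.+1.
Proof.
move=> a1 b1; rewrite !lucas_vN altS /alt.
have := lucas_v_gt0 n a1 b1; have := lucas_v_gt0 n.+1 a1 b1; case: (odd n); lia.
Qed.

Lemma listed_u_AP3 (A B : int) (k l m : nat) :
  listed_u A B k l m -> is_AP3 (lucas_u A B k) (lucas_u A B l) (lucas_u A B m).
Proof.
case=> [[[-> ->] [[-> -> ->]|[-> -> ->]|[t [-> -> ->]]]]|].
- by [].
- by [].
- apply: AP3_rec11 => [n|]; first by rewrite lucas_uSS !mul1r.
  exact: lucas_u_gt0.
case=> [[[-> ->] [[-> -> ->]|[t [-> -> ->]]]]|]; first by [].
  apply: AP3_recN11 => [n|]; first by rewrite lucas_uSS mulN1r mul1r.
  exact: lucas_u_neg_neqS.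
case=> [[[-> ->] [t t1 klm]]|].
  have E : lucas_u 1 2 (2 * t + 2) = 2 * lucas_u 1 2 (2 * t + 1) - 1.
    by rewrite addn2 addn1 lucas_u12S oddS oddM.
  have lt : lucas_u 1 2 2 < lucas_u 1 2 (2 * t + 1) by apply: lucas_u_lt; lia.
  have u2 : lucas_u 1 2 2 = 1 by [].
  have u1 : lucas_u 1 2 1 = 1 by [].
  by case: klm => -[-> -> ->]; apply: is_AP3P; rewrite ?u1 ?u2 //; lia.
case=> [[[-> ->] [t [-> -> ->]]]|].
  apply: AP3_recN12 => [n|]; first by rewrite lucas_uSS mulN1r.
  exact: lucas_u_neg_neqS.
case=> [[-> [B1 [-> -> ->]]]|]; first by apply: is_AP3P => //=; lia.
case=> [[-> [B1 [[-> -> ->]|[-> -> ->]]]]|[-> [B1 [-> -> ->]]]]; by apply: is_AP3P => /=; lia.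
Qed.

Lemma unlisted_u_AP3 (A B : int) (k l m : nat) :
  unlisted_u A B k l m -> is_AP3 (lucas_u A B k) (lucas_u A B l) (lucas_u A B m).
Proof. by case=> [[[-> ->] [-> -> ->]]|[[-> ->] [-> -> ->]]]. Qed.

Lemma listed_v_AP3 (A B : int) (k l m : nat) :
  listed_v A B k l m -> is_AP3 (lucas_v A B k) (lucas_v A B l) (lucas_v A B m).
Proof.
case=> [[[-> ->] [[-> -> ->]|[t [-> -> ->]]]]|].
- by [].
- apply: AP3_rec11 => [n|]; first by rewrite lucas_vSS !mul1r.
  exact: lucas_v_gt0.
case=> [[[-> ->] [t [-> -> ->]]]|].
  apply: AP3_recN11 => [n|]; first by rewrite lucas_vSS mulN1r mul1r.
  exact: lucas_v_neg_neqS.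
case=> [[[-> ->] [[|t] // _ [-> -> ->]]]|].
  (* The index is a successor here, so its truncated predecessor is a true one. *)
  have := @AP3_recN12 (lucas_v (-1) 2) t.
  rewrite subn1 !addn1 addn2 => AP; apply/is_AP3_sym/AP => [n|].
    by rewrite lucas_vSS mulN1r.
  exact: lucas_v_neg_neqS.
by case=> [|[|]] [[-> ->] [-> -> ->]].
Qed.

(** * Assembly over the signs of A and B *)

Lemma AP3_lucas_u (A B : int) (k l m : nat) :
  A <> 0 -> B <> 0 -> 0 < A ^+ 2 + 4 * B ->
  is_AP3 (lucas_u A B k) (lucas_u A B l) (lucas_u A B m) ->
  up_to_swap (listed_u A B) k l m \/ up_to_swap (unlisted_u A B) k l m.
Proof.
move=> A0 B0 D; wlog km : k m / (k < m)%N => [H AP|].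
  case: (ltngtP k m) => [km|mk|E]; first exact: H.
    by case: (H m k mk (is_AP3_sym AP)) => -[]; rewrite /up_to_swap; auto.
  by case: AP; rewrite E.
have [Bpos|Bneg] : 1 <= B \/ B <= -1 by lia.
  have [Apos|Aneg] : 1 <= A \/ A <= -1 by lia.
    by case/(lucas_u_AP3_pos Apos Bpos km) => ?; [left|right]; left.
  have [a1 ->] : 1 <= - A /\ A = - - A by lia.
  exact: lucas_u_AP3_neg.
(* For B <= -1 the positive discriminant gives A^2 > 4, hence |A| >= 3. *)
rewrite expr2 in D.
have [b1 ->] : 1 <= - B /\ B = - - B by lia.
have [Apos|Aneg] : 1 <= A \/ A <= -1 by lia.
  by move=> AP; case: (@lucas_u_AP3_pos_negB A (- B) k l m _ b1 _ km AP); nia.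
have -> : A = - - A by lia.
by move=> AP; case: (@lucas_u_AP3_neg_negB (- A) (- B) k l m _ b1 _ km AP); nia.
Qed.

Lemma AP3_lucas_v (A B : int) (k l m : nat) :
  A <> 0 -> B <> 0 -> 0 < A ^+ 2 + 4 * B ->
  is_AP3 (lucas_v A B k) (lucas_v A B l) (lucas_v A B m) ->
  up_to_swap (listed_v A B) k l m.
Proof.
move=> A0 B0 D; wlog km : k m / (k < m)%N => [H AP|].
  case: (ltngtP k m) => [km|mk|E]; first exact: H.
    by case: (H m k mk (is_AP3_sym AP)); rewrite /up_to_swap; auto.
  by case: AP; rewrite E.
move=> AP; left; move: AP.
have [Bpos|Bneg] : 1 <= B \/ B <= -1 by lia.
  have [Apos|Aneg] : 1 <= A \/ A <= -1 by lia.
    exact: lucas_v_AP3_pos.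
  have [a1 ->] : 1 <= - A /\ A = - - A by lia.
  exact: lucas_v_AP3_neg.
rewrite expr2 in D.
have [b1 ->] : 1 <= - B /\ B = - - B by lia.
have [Apos|Aneg] : 1 <= A \/ A <= -1 by lia.
  by move=> AP; case: (@lucas_v_AP3_pos_negB A (- B) k l m _ b1 _ km AP); nia.
have -> : A = - - A by lia.
by apply: lucas_v_AP3_neg_negB => //; nia.
Qed.

Theorem theorem2 (A B : int) (alpha beta : algC)
    (hA : A <> 0) (hB : B <> 0)
    (hroots : char_poly2 A B = ('X - alpha%:P) * ('X - beta%:P))
    (hnondeg : ~ is_root_of_unity (alpha / beta))
    (hdisc : 0 < A ^+ 2 + 4 * B) :
  (forall k l m : nat,
     is_AP3 (lucas_u A B k) (lucas_u A B l) (lucas_u A B m)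
     <-> up_to_swap (listed_u A B) k l m \/ up_to_swap (unlisted_u A B) k l m)
  /\
  (forall k l m : nat,
     is_AP3 (lucas_v A B k) (lucas_v A B l) (lucas_v A B m)
     <-> up_to_swap (listed_v A B) k l m).
Proof.
split=> k l m; split.
- exact: AP3_lucas_u.
- by case=> [[/listed_u_AP3|/listed_u_AP3/is_AP3_sym]|
            [/unlisted_u_AP3|/unlisted_u_AP3/is_AP3_sym]].
- exact: AP3_lucas_v.
- by case=> [/listed_v_AP3|/listed_v_AP3/is_AP3_sym].
Qed.
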